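(* Let $N\ge 1$ and let $\mathbf w^{\mathrm{start}},\mathbf w^{\mathrm{end}}\in\mathbb R^N$ be weight vectors (positive components summing to $1$). Set $\eta_i^{\mathrm{start}}=\sqrt{w_i^{\mathrm{start}}}$, $\eta_i^{\mathrm{end}}=\sqrt{w_i^{\mathrm{end}}}$, $\Omega=\arccos\left(\sum_i\sqrt{w_i^{\mathrm{start}}w_i^{\mathrm{end}}}\right)$ and $$\boldsymbol\eta(t)=\frac{\sin((1-t)\Omega)}{\sin\Omega}\,\boldsymbol\eta^{\mathrm{start}}+\frac{\sin(t\Omega)}{\sin\Omega}\,\boldsymbol\eta^{\mathrm{end}}.$$ Then the SLERP midpoint, i.e. the weight vector with components $\eta_i(1/2)^2$, is exactly equal to the (AM+GM)/normalise midpoint: for every $i$, $$\eta_i(1/2)^2=\frac{\mathrm{AM}_i+\mathrm{GM}_i}{\sum_{j=1}^N(\mathrm{AM}_j+\mathrm{GM}_j)},\qquad \mathrm{AM}_i=\frac{w_i^{\mathrm{start}}+w_i^{\mathrm{end}}}{2},\quad \mathrm{GM}_i=\sqrt{w_i^{\mathrm{start}}w_i^{\mathrm{end}}}.$$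
   Context: SLERP (spherical linear interpolation) is performed on the unit sphere in the Hellinger coordinates $\eta_i=\sqrt{w_i}$ and mapped back to weights by squaring. When $\mathbf w^{\mathrm{start}}=\mathbf w^{\mathrm{end}}$ ($\Omega=0$), $\boldsymbol\eta(t)$ is understood as the constant $\boldsymbol\eta^{\mathrm{start}}$. *)

(* Defs.v *)
From mathcomp Require Import all_boot all_order all_algebra.
From mathcomp Require Import reals trigo.

Set Implicit Arguments.
Unset Strict Implicit.
Unset Printing Implicit Defensive.

Import Order.TTheory GRing.Theory Num.Theory.

Local Open Scope ring_scope.

Definition weight_vector (R : realType) (N : nat) (w : 'rV[R]_N) : Prop :=
  (forall i, 0 < w 0 i) /\ \sum_i w 0 i = 1.

(* Hellinger coordinates: weight vectors go to the unit sphere. *)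
Definition hellinger (R : realType) (N : nat) (w : 'rV[R]_N) : 'rV[R]_N :=
  \row_i Num.sqrt (w 0 i).

Definition slerp_angle (R : realType) (N : nat) (ws we : 'rV[R]_N) : R :=
  acos (\sum_i Num.sqrt (ws 0 i * we 0 i)).

(* For equal endpoints the angle is 0 and the quotients of sines are
   meaningless, so the path is constant by convention. *)
Definition slerp (R : realType) (N : nat) (ws we : 'rV[R]_N) (t : R) :
    'rV[R]_N :=
  if ws == we then hellinger ws
  else let Omega := slerp_angle ws we in
       (sin ((1 - t) * Omega) / sin Omega) *: hellinger ws
       + (sin (t * Omega) / sin Omega) *: hellinger we.

Definition slerp_weights (R : realType) (N : nat) (ws we : 'rV[R]_N) (t : R) :
    'rV[R]_N :=
  \row_i (slerp ws we t 0 i) ^+ 2.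

Definition AM (R : realType) (N : nat) (ws we : 'rV[R]_N) : 'rV[R]_N :=
  \row_i ((ws 0 i + we 0 i) / 2).

Definition GM (R : realType) (N : nat) (ws we : 'rV[R]_N) : 'rV[R]_N :=
  \row_i Num.sqrt (ws 0 i * we 0 i).

(* Main.v *)
(* At t = 1/2 both coefficients equal sin (Omega/2) / sin Omega
   = 1 / (2 cos (Omega/2)), whose square is 1 / (2 (1 + cos Omega)); moreover
   (sqrt a + sqrt b)^2 = 2 (AM + GM), and the normalising sum is
   1 + cos Omega since the AM part sums to 1. *)
Require Import Defs.
From mathcomp Require Import all_boot all_order all_algebra.
From mathcomp Require Import reals trigo.
From mathcomp Require Import ring lra.

Import Order.TTheory GRing.Theory Num.Theory.
Local Open Scope ring_scope.

Lemma sqr_addr_sqrt (R : realType) (a b : R) : 0 <= a -> 0 <= b ->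
  (Num.sqrt a + Num.sqrt b) ^+ 2 = 2 * ((a + b) / 2 + Num.sqrt (a * b)).
Proof. by move=> a0 b0; rewrite sqrrD !sqr_sqrtr// sqrtrM//; field. Qed.

Lemma sqr_subr_sqrt (R : realType) (a b : R) : 0 <= a -> 0 <= b ->
  (Num.sqrt a - Num.sqrt b) ^+ 2 = a + b - 2 * Num.sqrt (a * b).
Proof. by move=> a0 b0; rewrite sqrrB !sqr_sqrtr// sqrtrM//; ring. Qed.

Lemma sum_AM_GM (R : realType) (N : nat) (ws we : 'rV[R]_N) :
  weight_vector ws -> weight_vector we ->
  \sum_(j < N) (AM ws we 0 j + GM ws we 0 j)
    = 1 + \sum_i Num.sqrt (ws 0 i * we 0 i).
Proof.
move=> [_ ws1] [_ we1]; under eq_bigr do rewrite !mxE.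
by rewrite big_split/= -mulr_suml big_split/= ws1 we1; field.
Qed.

(** The squared Euclidean distance between the Hellinger vectors is 2 minus twice this sum, and it
    is positive because the square root is injective on nonnegative numbers. This makes the slerp
    angle nonzero for distinct endpoints. *)
Lemma sum_GM_lt1 (R : realType) (N : nat) (ws we : 'rV[R]_N) :
  weight_vector ws -> weight_vector we -> ws != we ->
  \sum_i Num.sqrt (ws 0 i * we 0 i) < 1.
Proof.
move=> [ws0 ws1] [we0 we1] neq.
have dist : \sum_i (Num.sqrt (ws 0 i) - Num.sqrt (we 0 i)) ^+ 2
    = 2 - 2 * \sum_i Num.sqrt (ws 0 i * we 0 i).
  under eq_bigr do rewrite sqr_subr_sqrt ?ltW//.
  by rewrite sumrB big_split/= ws1 we1 mulr_sumr.
have : 0 < \sum_i (Num.sqrt (ws 0 i) - Num.sqrt (we 0 i)) ^+ 2.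
  rewrite lt0r sumr_ge0 ?andbT => [|i _]; last exact: sqr_ge0.
  apply: contra neq; rewrite psumr_eq0 => [/allP eq0|i _]; last exact: sqr_ge0.
  apply/eqP/rowP => i; have := eq0 i (mem_index_enum i).
  by rewrite /= sqrf_eq0 subr_eq0 eqr_sqrt ?ltW// => /eqP.
rewrite dist; lra.
Qed.

(** With [y = x / 2], the double-angle formulas give [sin x = 2 sin y cos y] and
    [1 + cos x = 2 cos y ^ 2]. The first also shows that [sin y] and [cos y] are nonzero, so they
    may be cancelled. *)
Lemma sqr_sin_half_div_sin (R : realType) (x : R) :
  sin x != 0 ->
  (sin (x / 2) / sin x) ^+ 2 = (2 * (1 + cos x))^-1.
Proof.
have xE : x = (x / 2) *+ 2 by rewrite -mulr_natr; field.
set y := x / 2 in xE *.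
have -> : sin x = cos y * sin y * 2 by rewrite xE sin_mulr2n mulr_natr.
have -> : cos x = cos y ^+ 2 * 2 - 1 by rewrite xE cos_mulr2n mulr_natr.
move=> /negP sin2_neq0.
have [c0 s0] : cos y != 0 /\ sin y != 0.
  by split; apply/eqP => eq0; apply: sin2_neq0; rewrite eq0 ?(mul0r, mulr0).
have -> : 2 * (1 + (cos y ^+ 2 * 2 - 1)) = 4 * cos y ^+ 2 by ring.
by field; rewrite c0 s0.
Qed.

Theorem theorem2 (R : realType) (N : nat) (hN : (1 <= N)%N)
    (ws we : 'rV[R]_N) (hws : weight_vector ws) (hwe : weight_vector we) :
  forall i : 'I_N,
    slerp_weights ws we (1 / 2) 0 i =
      (AM ws we 0 i + GM ws we 0 i) /
        \sum_(j < N) (AM ws we 0 j + GM ws we 0 j).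
Proof.
move=> i; rewrite sum_AM_GM//; have [ws0 ws1] := hws; have [we0 _] := hwe.
rewrite /slerp_weights mxE /slerp; case: eqVneq => [<-|neq].
  (* Equal endpoints: AM and GM both reduce to [ws], so the normalising sum is 2 and the quotient is
     [ws 0 i]. *)
  have sqrtM j : Num.sqrt (ws 0 j * ws 0 j) = ws 0 j.
    by rewrite -expr2 sqrtr_sqr ger0_norm ?ltW.
  under eq_bigr do rewrite sqrtM.
  by rewrite ws1 !mxE sqrtM sqr_sqrtr ?ltW//; field.
have c_lt1 := sum_GM_lt1 _ _ _ _ hws hwe neq.
have c_ge0 : 0 <= \sum_i Num.sqrt (ws 0 i * we 0 i).
  by apply: sumr_ge0 => j _; apply: sqrtr_ge0.
rewrite /slerp_angle; set c := \sum_i _ in c_lt1 c_ge0 *.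
have cosK : cos (acos c) = c by rewrite acosK// in_itv/=; lra.
(* Here [sin (acos c) ^ 2 = 1 - c ^ 2], which is positive since [0 <= c < 1]. *)
have sin_neq0 : sin (acos c) != 0.
  by rewrite -sqrf_eq0 sin2cos2 cosK gt_eqF//; nra.
rewrite !mxE (_ : 1 - 1 / 2 = 1 / 2 :> R); last by field.
have -> : 1 / 2 * acos c = acos c / 2 by field.
(* The two coefficients now coincide and factor out of the sum of square roots. *)
rewrite -mulrDr exprMn sqr_sin_half_div_sin//.
rewrite sqr_addr_sqrt ?ltW// cosK; field; lra.
Qed.
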